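(* Let $G$ be a finite simple graph with vertices totally ordered as $v_1<v_2<\cdots<v_n$, and let $P(G,t)$ be its chromatic polynomial. Then $P(G,t)=IF(G,t)$ if and only if $v_1<v_2<\cdots<v_n$ is a perfect elimination ordering, i.e., for each $i$ the neighbors of $v_i$ that come before $v_i$ in the ordering form a clique of $G$.
   Context: A subtree of $G$ is increasing if the vertices along any path starting at its minimum vertex increase in the ordering. Let $f_k$ be the number of spanning forests of $G$ with $k$ edges all of whose components are increasing trees. The increasing spanning forest generating function is $IF(G,t)=\sum_{k=0}^{n-1}(-1)^k f_k t^{n-k}$. *)

(* Defs.v *)
From HB Require Import structures.
From mathcomp Require Import all_boot all_order all_algebra.
Set Implicit Arguments.
Unset Strict Implicit.
Unset Printing Implicit Defensive.
Import Order.TTheory GRing.Theory Num.Theory.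
Local Open Scope ring_scope.

(* A simple graph on T is a symmetric irreflexive relation e : rel T. *)

Definition proper_coloring (T : finType) (e : rel T) (q : nat)
    (f : {ffun T -> 'I_q}) : bool :=
  [forall x, forall y, e x y ==> (f x != f y)].

Definition num_colorings (T : finType) (e : rel T) (q : nat) : nat :=
  #|[set f : {ffun T -> 'I_q} | proper_coloring e f]|.

Definition is_chromatic_poly (T : finType) (e : rel T) (p : {poly int}) :=
  forall q : nat, p.[q%:R] = (num_colorings e q)%:R.

(* Deletion-contraction, for an edge list that may contain loops. *)
Lemma separating_poly (T : finType) (L : seq (T * T)) :
  {p : {poly int} | forall q : nat,
    p.[q%:R] = #|[set f : {ffun T -> 'I_q} | all (fun u => f u.1 != f u.2) L]|%:R}.
Proof.
move En: (size L) => n; elim: n T L En => [|n IHn] T L.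
  move/eqP/nilP => ->; exists ('X^#|T|) => q.
  rewrite hornerXn -natrX; congr _%:R.
  rewrite -[in LHS](card_ord q) -card_ffun -cardsT.
  by apply: eq_card => f; rewrite !inE.
case: L => [//|[x y] L] /= [sL].
have [p1 hp1] := IHn T L sL.
have [<-|nxy] := eqVneq x y.
  exists 0 => q; rewrite horner0; set A := [set _ | _].
  suff -> : A = set0 by rewrite cards0.
  by apply/setP => f; rewrite !inE eqxx.
pose T' : finType := {z | z != y}.
pose x' : T' := Sub x nxy.
pose c (z : T) : T' := insubd x' z.
have cK (z : T') : c (val z) = z by rewrite /c valKd.
have [p2 hp2] := IHn T' [seq (c u.1, c u.2) | u <- L] (etrans (size_map _ _) sL).
exists (p1 - p2) => q; rewrite hornerD hornerN hp1 hp2.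
set A := [set f | _]; set B := [set f | _]; set C := [set f | _].
apply/eqP; rewrite subr_eq -natrD; apply/eqP; congr _%:R.
rewrite -(cardsID [set f : {ffun T -> 'I_q} | f x == f y] A) addnC; congr addn.
  by apply: eq_card => f; rewrite !inE.
pose h (g : {ffun T' -> 'I_q}) := [ffun z => g (c z)].
have hinj : injective h.
  move=> g1 g2 /ffunP E; apply/ffunP => z.
  by have := E (val z); rewrite !ffunE cK.
rewrite -(card_imset _ hinj); apply: eq_card => f.
have cx : c x = x' by rewrite /c (_ : x = val x') // valKd.
have cy : c y = x' by rewrite /c /insubd insubF // eqxx.
apply/idP/imsetP => [|[g gB ->]].
  rewrite !inE => /andP[fL /eqP fxy].
  have fc z : f (val (c z)) = f z.
    have [->|nzy] := eqVneq z y; first by rewrite cy.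
    by rewrite /c insubdK.
  exists [ffun z => f (val z)].
    rewrite inE all_map; apply/allP => u uL /=.
    by rewrite !ffunE !fc (allP fL).
  by apply/ffunP => z; rewrite !ffunE fc.
move: gB; rewrite !inE all_map !ffunE cx cy eqxx andbT => /allP gL.
by apply/allP => u /gL /=; rewrite !ffunE.
Qed.

Lemma chromatic_poly_exists (T : finType) (e : rel T) :
  {p : {poly int} | is_chromatic_poly e p}.
Proof.
have [p hp] := separating_poly [seq u <- enum {: T * T} | e u.1 u.2].
exists p => q; rewrite hp; congr _%:R; apply: eq_card => f; rewrite !inE.
apply/allP/'forall_forallP => [fL x y|fe [x y]].
  by apply/implyP => exy; apply: (fL (x, y)); rewrite mem_filter mem_enum exy.
by rewrite mem_filter => /andP[/= exy _]; apply: (implyP (fe x y)).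
Qed.

Definition chromatic_poly (T : finType) (e : rel T) : {poly int} :=
  sval (chromatic_poly_exists e).

Lemma chromatic_polyP (T : finType) (e : rel T) :
  is_chromatic_poly e (chromatic_poly e).
Proof. exact: svalP. Qed.

Lemma chromatic_poly_unique (T : finType) (e : rel T) (p : {poly int}) :
  is_chromatic_poly e p -> p = chromatic_poly e.
Proof.
move=> hp; apply/eqP; rewrite -subr_eq0; apply/negPn/negP => nz.
set d := p - _ in nz.
pose rs : seq int := [seq k%:R | k <- iota 0 (size d)].
suff /(max_poly_roots nz) : all (root d) rs.
  rewrite size_map size_iota ltnn => /(_ _)/negP; apply=> //.
  by rewrite map_inj_uniq ?iota_uniq // => i j /eqP; rewrite eqr_nat => /eqP.
apply/allP => _ /mapP[k _ ->]; rewrite rootE /d hornerD hornerN.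
by rewrite hp chromatic_polyP subrr.
Qed.

Definition edges (T : finType) (e : rel T) : {set {set T}} :=
  [set [set u.1; u.2] | u : T * T & e u.1 u.2].

(* The spanning subgraph of G with edge set F; F contains no singletons when
   F \subset edges e and e is irreflexive. *)
Definition subgraph (T : finType) (F : {set {set T}}) : rel T :=
  [rel x y | [set x; y] \in F].

(* [:: x; y] with r x y is a [cycle] traversing one edge back and forth, so a
   graph cycle has size at least 3.  Bounding the size by #|T| loses nothing on
   duplicate-free sequences; see acyclicP. *)
Definition acyclic (T : finType) (r : rel T) : bool :=
  [forall k : 'I_#|T|.+1, forall c : k.-tuple T,
    (cycle r c && uniq c) ==> (k < 3)%N].

Lemma acyclicP (T : finType) (r : rel T) :
  reflect (forall c : seq T, cycle r c -> uniq c -> (size c < 3)%N)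
          (acyclic r).
Proof.
apply: (iffP 'forall_forallP) => [H c cc uc|H k c].
  have sc : (size c < #|T|.+1)%N by rewrite ltnS -(card_uniqP uc) max_card.
  by have /implyP := H (Ordinal sc) (in_tuple c); rewrite cc uc; apply.
by apply/implyP => /andP[cc uc]; rewrite -[X in (X < _)%N](size_tuple c) H.
Qed.

Definition spanning_forest (T : finType) (e : rel T) (F : {set {set T}}) :=
  (F \subset edges e) && acyclic (subgraph F).

Definition component_min (d : Order.disp_t) (T : finOrderType d) (r : rel T)
    (x : T) : bool :=
  [forall y, connect r x y ==> (x <= y)%O].

Definition increasing_from (d : Order.disp_t) (T : finOrderType d) (r : rel T)
    (x : T) : bool :=
  [forall k : 'I_#|T|, forall p : k.-tuple T,
    (path r x p && uniq (x :: p)) ==> path <%O x p].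

Lemma increasing_fromP (d : Order.disp_t) (T : finOrderType d) (r : rel T)
    (x : T) :
  reflect (forall p : seq T, path r x p -> uniq (x :: p) -> path <%O x p)
          (increasing_from r x).
Proof.
apply: (iffP 'forall_forallP) => [H p pp up|H k p].
  have sp : (size p < #|T|)%N.
    by have := max_card (mem (x :: p)); rewrite (card_uniqP up).
  by have /implyP := H (Ordinal sp) (in_tuple p); rewrite pp up; apply.
by apply/implyP => /andP[pp up]; apply: H.
Qed.

(* The components of F correspond to their minimum vertices x, and the paths of
   such a component starting at x are the duplicate-free F-paths from x. *)
Definition increasing_spanning_forest (d : Order.disp_t) (T : finOrderType d)
    (e : rel T) (F : {set {set T}}) : bool :=
  spanning_forest e F &&
  [forall x, component_min (subgraph F) x ==> increasing_from (subgraph F) x].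

Definition num_isf (d : Order.disp_t) (T : finOrderType d) (e : rel T)
    (k : nat) : nat :=
  #|[set F : {set {set T}} | increasing_spanning_forest e F & #|F| == k]|.

Definition isf_poly (d : Order.disp_t) (T : finOrderType d) (e : rel T) :
    {poly int} :=
  \sum_(k < #|T|) ((-1) ^+ k * (num_isf e k)%:R) *: 'X^(#|T| - k).

Definition clique (T : finType) (e : rel T) (A : {set T}) : Prop :=
  {in A &, forall x y, x != y -> e x y}.

Definition perfect_elimination (d : Order.disp_t) (T : finOrderType d)
    (e : rel T) : Prop :=
  forall v : T, clique e [set x | e v x & (x < v)%O].

(* Main.v *)
Require Import Defs.
From HB Require Import structures.
From mathcomp Require Import all_boot all_order all_algebra.

Set Implicit Arguments.
Unset Strict Implicit.
Unset Printing Implicit Defensive.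
Import Order.TTheory GRing.Theory Num.Theory.

(** Writing [d_v] for the number of neighbours of [v] below [v], both
    polynomials are compared with [\prod_v ('X - d_v)].  A spanning subgraph is
    an increasing forest iff every vertex is joined to at most one smaller
    vertex, its parent; choosing the parents independently gives
    [isf_poly e = \prod_v ('X - d_v)].  On the other side, color the vertices in
    increasing order: [v] has [q] minus the number of colors on its lower
    neighbours choices, which is at least [q - d_v], with equality iff these
    neighbours have distinct colors.  This is forced if they form a clique.  If
    two of them are not adjacent and [q = #|T|], some coloring of the smaller
    vertices identifies their colors, so that there are strictly more than
    [\prod_v (q - d_v)] proper colorings. *)

(** * Induction along the vertex order *)

Definition lower_nbrs (d : Order.disp_t) (T : finOrderType d) (e : rel T)
    (v : T) : {set T} :=
  [set x | e v x & (x < v)%O].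

(** A nonempty down-closed set consists of its maximum [v] and everything below [v], so strong
    induction on cardinality applies. This is what lets the vertices be colored in increasing
    order. *)
Lemma lower_set_ind (d : Order.disp_t) (T : finOrderType d)
    (P : {set T} -> Prop) :
  P set0 ->
  (forall v, P [set x | (x < v)%O] -> P (v |: [set x | (x < v)%O])) ->
  P setT.
Proof.
move=> P0 PU.
suff H n (S : {set T}) : #|S| = n ->
    (forall x y, y \in S -> (x < y)%O -> x \in S) -> P S.
  by apply: (H _ _ erefl) => x y; rewrite !inE.
elim/ltn_ind: n S => n IHn S Sn Sdown.
have [->//|[x0 x0S]] := set_0Vmem S.
have [v vS vmax] := @Order.TotalTheory.arg_maxP _ _ _ x0 (mem S) id x0S.
have SE : S = v |: [set x | (x < v)%O].
  apply/setP => x; rewrite !inE; apply/idP/orP => [xS|[/eqP->//|]].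
    by have := vmax x xS; rewrite /= le_eqVlt => /orP.
  exact: Sdown.
rewrite SE; apply: PU; apply: (IHn #|[set x | (x < v)%O]|) => //.
  by rewrite -Sn [in X in (_ < X)%N]SE cardsU1 inE ltxx.
by move=> x y; rewrite !inE => yv xy; apply: lt_trans yv.
Qed.

(** * Counting colorings vertex by vertex *)

Section PartialColorings.
Variables (d : Order.disp_t) (T : finOrderType d) (e : rel T) (q : nat).
Hypotheses (e_sym : symmetric e) (e_irr : irreflexive e).

(** [None] marks exactly the uncolored vertices, so the colorings of all sets [S] live in one finite
    type and each is counted once. *)
Definition partial_colorings (S : {set T}) : {set {ffun T -> option 'I_q}} :=
  [set g : {ffun T -> option 'I_q} | [forall x, (g x != None) == (x \in S)]
     & [forall x in S, forall y in S, e x y ==> (g x != g y)]].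

Lemma partial_coloringsP (S : {set T}) (g : {ffun T -> option 'I_q}) :
  reflect ((forall x, (g x != None) = (x \in S)) /\
           {in S &, forall x y, e x y -> g x != g y})
          (g \in partial_colorings S).
Proof.
rewrite inE; apply: (iffP andP) => -[gS gE]; split.
- by move=> x; move/forallP: gS => /(_ x)/eqP.
- move=> x y xS yS; apply/implyP; move/forall_inP: gE => /(_ x xS).
  by move/forall_inP => /(_ y yS).
- by apply/forallP => x; rewrite gS.
apply/forall_inP => x xS; apply/forall_inP => y yS; apply/implyP.
exact: gE.
Qed.

Definition free_colors (g : {ffun T -> option 'I_q}) (v : T) : {set 'I_q} :=
  [set c | Some c \notin g @: lower_nbrs e v].

Lemma partial_colorings0 : #|partial_colorings set0| = 1%N.
Proof.
rewrite (_ : partial_colorings set0 = [set [ffun=> None]]) ?cards1 //.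
apply/setP => g; rewrite in_set1; apply/partial_coloringsP/eqP => [[gS _]|->].
  by apply/ffunP => x; rewrite ffunE; apply/eqP/negPn; rewrite gS inE.
by split=> x; rewrite ?ffunE !inE.
Qed.

Lemma partial_coloringsT : #|partial_colorings setT| = num_colorings e q.
Proof.
pose h (f : {ffun T -> 'I_q}) := [ffun x => Some (f x)].
have hinj : injective h.
  move=> f1 f2 /ffunP E; apply/ffunP => x.
  by have := E x; rewrite !ffunE => -[].
rewrite /num_colorings -(card_imset _ hinj); apply: eq_card => g.
apply/partial_coloringsP/imsetP => [[gS gE]|[f]].
  (* The default required by [odflt], read off from the total map [g] so that [q = 0] needs no
     separate case; it is never selected. *)
  have dfl : T -> 'I_q.
    by move=> x; have := gS x; rewrite inE; case: (g x) => [c|].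
  exists [ffun x => odflt (dfl x) (g x)]; last first.
    apply/ffunP => x; rewrite !ffunE; have := gS x; rewrite inE.
    by case: (g x).
  rewrite inE; apply/'forall_forallP => x y; apply/implyP => exy.
  rewrite !ffunE; have := gE x y (in_setT _) (in_setT _) exy.
  have := gS x; have := gS y; rewrite !inE.
  by case: (g x) => [a|//]; case: (g y) => [b|//].
rewrite inE => /'forall_forallP fE ->; split=> [x|x y _ _ exy].
  by rewrite ffunE inE.
by rewrite !ffunE; apply: (implyP (fE x y) exy).
Qed.

(** Erase the color of [v]: the fibre over [g] is in bijection with the free colors of [v], because
    the neighbours of [v] colored by [g] are its lower neighbours. *)
Lemma card_partial_coloringsU1 (v : T) :
  #|partial_colorings (v |: [set x | (x < v)%O])| =
  (\sum_(g in partial_colorings [set x | (x < v)%O]) #|free_colors g v|)%N.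
Proof.
set S := [set x | _].
pose res (f : {ffun T -> option 'I_q}) : {ffun T -> option 'I_q} :=
  [ffun x => if x == v then None else f x].
pose ext (g : {ffun T -> option 'I_q}) c : {ffun T -> option 'I_q} :=
  [ffun x => if x == v then Some c else g x].
have Sv x : x \in S -> x != v by rewrite inE lt_neqAle => /andP[].
rewrite -sum1_card (partition_big res (mem (partial_colorings S))) /=; last first.
  move=> f /partial_coloringsP[fS fE]; apply/partial_coloringsP; split.
    move=> x; rewrite ffunE; case: (eqVneq x v) => [->|xv]; first by rewrite inE ltxx.
    by rewrite fS in_setU1 (negPf xv).
  move=> x y xS yS exy; rewrite !ffunE (negPf (Sv _ xS)) (negPf (Sv _ yS)).
  by apply: fE => //; rewrite in_setU1 ?xS ?yS orbT.
apply: eq_bigr => g gC; have [gS gE] := partial_coloringsP _ _ gC.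
have ext_inj : injective (ext g).
  by move=> c1 c2 /ffunP/(_ v); rewrite !ffunE eqxx => -[].
rewrite -(card_imset _ ext_inj) sum1dep_card; apply: eq_card => f.
rewrite inE; apply/andP/imsetP => [[fC /eqP fg]|[c cF ->]].
  have [fS fE] := partial_coloringsP _ _ fC.
  have := fS v; rewrite setU11; case fv: (f v) => [c|//] _.
  exists c; last first.
    by apply/ffunP => x; rewrite -fg !ffunE; case: (eqVneq x v) => [->|].
  rewrite inE; apply/imsetP => -[x]; rewrite inE => /andP[evx xv].
  rewrite -fg ffunE lt_eqF // -fv => E.
  by have := fE v x; rewrite !inE eqxx xv orbT E eqxx => /(_ isT isT evx).
have cN x : x \in S -> e v x -> g x != Some c.
  move=> xS evx; apply: contraL cF => /eqP gx; rewrite inE negbK -gx.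
  by apply: imset_f; rewrite inE in xS; rewrite inE evx.
split; last first.
  apply/eqP/ffunP => x; rewrite !ffunE; case: (eqVneq x v) => // ->.
  by apply/esym/eqP/negPn; rewrite gS inE ltxx.
apply/partial_coloringsP; split.
  by move=> x; rewrite ffunE in_setU1; case: (eqVneq x v) => //= _; rewrite gS.
move=> x y; rewrite !in_setU1 !ffunE.
case: (eqVneq x v) => [->|xv]; case: (eqVneq y v) => [->|yv] //=.
- by rewrite e_irr.
- by move=> _ yS /(cN _ yS); rewrite eq_sym.
- by move=> xS _; rewrite e_sym => /(cN _ xS).
exact: gE.
Qed.

(** Through [Some], the colors that are not free form the image of the lower neighbours; [None] is
    not in this image since [g] colors everything below [v]. *)
Lemma card_free_colors (v : T) (g : {ffun T -> option 'I_q}) :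
  g \in partial_colorings [set x | (x < v)%O] ->
  (#|free_colors g v| + #|g @: lower_nbrs e v|)%N = q.
Proof.
move=> /partial_coloringsP[gS _].
rewrite -[RHS]card_ord -(cardsC (free_colors g v)); congr addn.
have Some_inj : injective (@Some 'I_q) by move=> ? ? [].
rewrite -(card_imset _ Some_inj); apply: eq_card => o.
apply/idP/imsetP => [oN|[c]]; last by rewrite !inE negbK => cN ->.
case: o oN => [c|] oN; first by exists c; rewrite // !inE negbK.
case/imsetP: oN => x; rewrite inE => /andP[_ xv] gx.
by have := gS x; rewrite inE xv -gx.
Qed.

Lemma card_free_colors_ge (v : T) (g : {ffun T -> option 'I_q}) :
  g \in partial_colorings [set x | (x < v)%O] ->
  (q - #|lower_nbrs e v| <= #|free_colors g v|)%N.
Proof.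
move=> /card_free_colors qE.
by rewrite leq_subLR -[leqLHS]qE addnC leq_add2r leq_imset_card.
Qed.

End PartialColorings.

(** * Comparison of the number of colorings with the product *)

(** Lower neighbours are pairwise adjacent, so a coloring is injective on them and [v] loses exactly
    [d_v] colors. A factor in [int] may be negative, but then there is no coloring left to extend
    and both sides of the recursion vanish. *)
Lemma num_colorings_perfect_elimination (d : Order.disp_t) (T : finOrderType d)
    (e : rel T) (q : nat) (e_sym : symmetric e) (e_irr : irreflexive e) :
  perfect_elimination e ->
  ((num_colorings e q)%:R = \prod_v (q%:R - #|lower_nbrs e v|%:R) :> int)%R.
Proof.
move=> peo; rewrite -partial_coloringsT.
rewrite [RHS](eq_bigl (fun x => x \in [set: T])); last by move=> x; rewrite inE.
apply: (@lower_set_ind _ _ (fun S => (#|partial_colorings e q S|%:R =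
   \prod_(v in S) (q%:R - #|lower_nbrs e v|%:R) :> int)%R)) => [|v IH].
  by rewrite partial_colorings0 big_set0.
rewrite big_setU1 ?inE ?ltxx //= -IH card_partial_coloringsU1 //.
rewrite natr_sum -sum1_card natr_sum mulr_sumr; apply: eq_bigr => g gC.
rewrite mulr1; apply/eqP; rewrite eq_sym subr_eq -natrD; apply/eqP.
congr (_%:R)%R; rewrite -[LHS](card_free_colors gC); congr addn.
have [_ gE] := partial_coloringsP _ _ _ gC.
apply: card_in_imset => x y xN yN gxy; apply/eqP/negPn/negP => nxy.
have exy := peo v x y xN yN nxy; move: xN yN; rewrite !inE.
move=> /andP[_ xv] /andP[_ yv].
by have := gE x y; rewrite !inE xv yv gxy eqxx => /(_ isT isT exy).
Qed.

Lemma card_lower_nbrs_lt (d : Order.disp_t) (T : finOrderType d) (e : rel T)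
    (v : T) : (#|lower_nbrs e v| < #|T|)%N.
Proof.
rewrite -cardsT; apply: proper_card; apply/properP.
by split=> //; exists v; rewrite // inE ltxx andbF.
Qed.

Lemma num_colorings_gt (d : Order.disp_t) (T : finOrderType d) (e : rel T)
    (e_sym : symmetric e) (e_irr : irreflexive e) (v a b : T) :
  a \in lower_nbrs e v -> b \in lower_nbrs e v -> a != b -> ~~ e a b ->
  (\prod_x (#|T| - #|lower_nbrs e x|) < num_colorings e #|T|)%N.
Proof.
move=> aN bN nab neab; rewrite -partial_coloringsT.
rewrite [ltnLHS](eq_bigl (fun x => x \in [set: T])); last by move=> x; rewrite inE.
(* The summand [(v \in S)] records an excess of one, gained when [v] is colored and kept afterwards
   because every later factor is positive. *)
pose Q (S : {set T}) := (\prod_(x in S) (#|T| - #|lower_nbrs e x|) + (v \in S)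
  <= #|partial_colorings e #|T| S|)%N.
suff : Q setT by rewrite /Q in_setT addn1.
apply: (lower_set_ind (P := Q)) => [|w]; rewrite {}/Q.
  by rewrite partial_colorings0 big_set0 inE.
set S := [set x | _] => IH.
rewrite big_setU1 ?inE ?ltxx //= card_partial_coloringsU1 //.
have free_ge g : g \in partial_colorings e #|T| S ->
    (#|T| - #|lower_nbrs e w| <= #|free_colors e g w|)%N.
  exact: card_free_colors_ge.
have dw := card_lower_nbrs_lt e w.
case: (eqVneq v w) => [vw|nvw] /=; last first.
  apply: (@leq_trans (#|partial_colorings e #|T| S| *
      (#|T| - #|lower_nbrs e w|))%N); last first.
    by rewrite -sum_nat_const; apply: leq_sum.
  rewrite mulnC (leq_trans _ (leq_mul IH (leqnn _))) //.
  rewrite mulnDl leq_add2l inE; case: (v < w)%O => //.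
  by rewrite mul1n subn_gt0.
subst w; move: (aN) (bN); rewrite !inE => /andP[eva av] /andP[evb bv].
(* With [#|T|] colors each vertex can serve as its own color. Giving [b] the color of [a] keeps the
   coloring proper, as they are not adjacent, and leaves [v] an extra free color. *)
pose g0 : {ffun T -> option 'I_#|T|} := [ffun x =>
  if (x < v)%O then Some (enum_rank (if x == b then a else x)) else None].
have g0C : g0 \in partial_colorings e #|T| S.
  apply/partial_coloringsP; split=> [x|x y]; rewrite !inE ffunE.
    by case: (x < v)%O.
  move=> xv yv exy; rewrite ffunE xv yv; apply/eqP => -[/enum_rank_inj].
  case: (eqVneq x b) => [xb|xb]; case: (eqVneq y b) => [yb|yb].
  - by move: exy; rewrite xb yb e_irr.
  - by move=> ay; move: neab; rewrite e_sym ay -xb exy.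
  - by move=> xa; move: neab; rewrite -xa -yb exy.
  - by move=> xy; move: exy; rewrite xy e_irr.
have g0_gt : (#|T| - #|lower_nbrs e v| < #|free_colors e g0 v|)%N.
  have qE := card_free_colors g0C.
  rewrite ltn_subLR ?(ltnW dw) // -[ltnLHS]qE addnC ltn_add2r.
  rewrite ltn_neqAle leq_imset_card andbT; apply/imset_injP => inj.
  by case/eqP: nab; apply: inj => //; rewrite !ffunE av bv eqxx if_same.
rewrite addn1 (bigD1 g0) //=.
move: IH; rewrite inE ltxx addn0 => IH.
apply: leq_ltn_trans (_ : _ <= #|partial_colorings e #|T| S| *
      (#|T| - #|lower_nbrs e v|))%N _; first by rewrite mulnC leq_mul2r IH orbT.
rewrite -sum_nat_const (bigD1 g0) //= -addSn leq_add //.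
by apply: leq_sum => g /andP[gC _]; apply: free_ge.
Qed.

(** * The unique-parent criterion for increasing forests *)

Lemma subgraph_sym (T : finType) (F : {set {set T}}) : symmetric (subgraph F).
Proof. by move=> x y; rewrite /subgraph /= setUC. Qed.

Lemma doubleton_eq (T : finType) (x y a b : T) :
  [set x; y] = [set a; b] -> x = a /\ y = b \/ x = b /\ y = a.
Proof.
move=> E; have := set21 x y; have := set22 x y; rewrite E => /set2P y_ab /set2P x_ab.
have := set21 a b; have := set22 a b; rewrite -E => /set2P b_xy /set2P a_xy.
by case: x_ab y_ab a_xy b_xy => ? [] ? [] ? [] ?; subst; auto.
Qed.

Lemma mem_edges (T : finType) (e : rel T) (x y : T) :
  symmetric e -> ([set x; y] \in edges e) = e x y.
Proof.
move=> e_sym; apply/imsetP/idP => [[[a b]]|exy]; last first.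
  by exists (x, y); rewrite // inE.
by rewrite inE /= => eab /doubleton_eq[[-> ->]|[-> ->]] //; rewrite e_sym.
Qed.

Section IncreasingForests.
Variables (d : Order.disp_t) (T : finOrderType d).
Implicit Types F : {set {set T}}.

Definition one_parent F :=
  forall v a b : T, (a < v)%O -> (b < v)%O ->
    [set v; a] \in F -> [set v; b] \in F -> a = b.

Lemma component_min_exists F (v : T) :
  exists2 m, component_min (subgraph F) m & connect (subgraph F) m v.
Proof.
have csym := sym_connect_sym (@subgraph_sym _ F).
have [m vm mmin] :=
  @Order.TotalTheory.arg_minP _ _ _ v (connect (subgraph F) v) id (connect0 _ _).
exists m; last by rewrite csym.
by apply/forallP => y; apply/implyP => my; apply: mmin; apply: connect_trans my.
Qed.

(* A path from the component minimum to one lower neighbour of [v], cut at the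
   other one if it meets it, can be continued through [v] to the remaining
   neighbour, and this last step descends. *)
Lemma increasing_one_parent F :
  (forall x, component_min (subgraph F) x -> increasing_from (subgraph F) x) ->
  one_parent F.
Proof.
move=> incr v a b av bv Fa Fb; apply/eqP/negPn/negP => nab.
have [m mmin mv] := component_min_exists F v.
have /increasing_fromP inc := incr m mmin.
have va : subgraph F v a by [].
have vb : subgraph F v b by [].
have [p0 pp0 pa0] := connectP (connect_trans mv (connect1 va)).
case/shortenP: pp0 pa0 => p pp up _ pa {p0}.
have descend p1 x y : path (subgraph F) m p1 -> uniq (m :: p1) ->
    last m p1 = x -> v \notin m :: p1 -> y \notin m :: p1 ->
    subgraph F v x -> subgraph F v y -> (y < v)%O -> False.
  move=> pp1 up1 lx vp1 yp1 vx vy yv.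
  have : path <%O m (rcons (rcons p1 v) y).
    apply: inc.
      by rewrite !rcons_path pp1 lx last_rcons subgraph_sym vx vy.
    rewrite -!rcons_cons !rcons_uniq vp1 up1 mem_rcons in_cons negb_or yp1.
    by rewrite lt_eqF.
  by rewrite !rcons_path last_rcons => /andP[_ /lt_trans/(_ yv)]; rewrite ltxx.
(* If the increasing path [p] met [v], its end [a] would be [v] or lie above it. *)
have vp : v \notin m :: p.
  apply/negP => vp; case/splitPl: vp pp up pa => p1 p2 lp1.
  rewrite cat_path last_cat lp1 => /andP[pp1 pp2] up pa.
  have := inc (p1 ++ p2); rewrite cat_path lp1 pp1 pp2 => /(_ isT up).
  rewrite cat_path lp1 => /andP[_ /(order_path_min lt_trans)/allP lt2].
  case: p2 pa lt2 {pp2 up} => [/= va'|c p2 /= aE]; first by rewrite va' ltxx in av.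
  by move=> /(_ _ (mem_last c p2)); rewrite -aE => /(lt_trans av); rewrite ltxx.
have [bp|bp] := boolP (b \in m :: p); last exact: (descend p a b).
case/splitPl: bp pp up pa vp => p1 p2 lp1.
rewrite cat_path last_cat lp1 => /andP[pp1 pp2].
rewrite -cat_cons cat_uniq mem_cat negb_or => /and3P[up1 /hasPn dis _].
move=> pa /andP[vp1 _]; apply: (descend p1 b a) => //; apply: dis.
case: p2 pa {pp2} => [/= ab|c p2 /= ->]; first by rewrite ab eqxx in nab.
exact: mem_last.
Qed.

(* The largest vertex of a cycle would have two parents. *)
Lemma one_parent_acyclic F :
  one_parent F -> acyclic (subgraph F).
Proof.
move=> one; apply/acyclicP => c cc uc; rewrite ltnNge; apply/negP => c3.
have [x0 x0c] : exists x0, x0 \in c.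
  by case: c c3 {cc uc} => // x c _; exists x; rewrite inE eqxx.
have [v vc vmax] := @Order.TotalTheory.arg_maxP _ _ _ x0 (mem c) id x0c.
have [i c' cE] := rot_to vc.
have c'v x : x \in c' -> (x < v)%O.
  move=> xc'; rewrite lt_neqAle; apply/andP; split; last first.
    have xc : x \in c by rewrite -(mem_rot i) cE inE xc' orbT.
    exact: vmax.
  apply: contraL xc' => /eqP->.
  by move: uc; rewrite -(rot_uniq i) cE => /andP[].
move: cc uc c3; rewrite -(rot_cycle i) -(rot_uniq i) -(size_rot i) cE.
(* The cycle, rotated to start at its maximum [v], has length at least 3, so the successor [a] and
   the predecessor [b] of [v] are distinct. *)
case: c' c'v {cE} => [//|a c']; case/lastP: c' => [//|c' b] c'v.
rewrite /= rcons_path last_rcons => /andP[va /andP[_ bv]].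
move=> /and3P[_ ac' _] _.
have nab : a != b by apply: contraNneq ac' => ->; rewrite mem_rcons inE eqxx.
have av : (a < v)%O by apply: c'v; rewrite inE eqxx.
have b_v : (b < v)%O by apply: c'v; rewrite inE mem_rcons inE eqxx orbT.
case/eqP: nab; apply: (one v) => //.
by have := bv; rewrite subgraph_sym.
Qed.

(** Consider the first descent, from [y] to [z]. If [y] is the start, minimality fails; otherwise
    [z] and the predecessor of [y] are both parents of [y], hence equal, and the path repeats a
    vertex. *)
Lemma one_parent_increasing F (x : T) :
  one_parent F -> component_min (subgraph F) x -> increasing_from (subgraph F) x.
Proof.
move=> one xmin; apply/increasing_fromP; elim/last_ind => // p z IHp.
rewrite rcons_path -rcons_cons rcons_uniq => /andP[pp yz] /andP[zp up].
have inc := IHp pp up; rewrite rcons_path inc /=.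
have [//|zy|zy] := ltgtP (last x p) z; last first.
  by move: zp; rewrite -zy mem_last.
case/lastP: p zp up inc pp yz zy {IHp} => [|p y] zp up inc pp /=.
  move=> xz zx; move/forallP: xmin => /(_ z); rewrite (connect1 xz) /=.
  by rewrite leNgt zx.
rewrite last_rcons => yz zy; move: inc pp; rewrite !rcons_path.
move=> /andP[_ wy] /andP[_ Fwy].
have /esym zw := one y _ _ wy zy (etrans (subgraph_sym _ _ _) Fwy) yz.
by move: zp; rewrite zw -rcons_cons mem_rcons inE mem_last orbT.
Qed.

Lemma increasing_spanning_forestP (e : rel T) F :
  reflect (F \subset edges e /\ one_parent F) (increasing_spanning_forest e F).
Proof.
apply: (iffP andP) => [[/andP[Fe _] inc]|[Fe one]].
  split=> //; apply: increasing_one_parent => x xmin.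
  by move/forallP: inc => /(_ x)/implyP; apply.
split; first by rewrite /spanning_forest Fe one_parent_acyclic.
by apply/forallP => x; apply/implyP; apply: one_parent_increasing.
Qed.

(** * Bijection between increasing forests and parent maps *)

(** [None] means that [v] is the root of its tree; such [v] are filtered out, so the default of
    [odflt] never occurs. *)
Definition parent_forest (g : {ffun T -> option T}) : {set {set T}} :=
  [set [set v; odflt v (g v)] | v in [set v | g v != None]].

(** Under [one_parent F] there is at most one candidate, so [pick] makes no real choice. *)
Definition parent_map F : {ffun T -> option T} :=
  [ffun v => [pick x | (x < v)%O && ([set v; x] \in F)]].

Definition parent_choices (e : rel T) (v : T) : pred (option T) :=
  fun o => if o is Some x then x \in lower_nbrs e v else true.

Section ParentMaps.
Variables (e : rel T) (g : {ffun T -> option T}).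
Hypothesis gP : g \in family (parent_choices e).

Lemma parent_lt (v x : T) : g v = Some x -> e v x /\ (x < v)%O.
Proof.
by move=> gv; have /familyP/(_ v) := gP; rewrite gv unfold_in /= inE => /andP.
Qed.

(** An edge can only come from its larger end: if it came from [x], then [v] would be the parent of
    [x] and lie below it. *)
Lemma mem_parent_forest (v x : T) : (x < v)%O ->
  ([set v; x] \in parent_forest g) = (g v == Some x).
Proof.
move=> xv; apply/imsetP/eqP => [[w]|gv]; last first.
  by exists v; rewrite ?inE gv.
rewrite inE; case gw: (g w) => [y|] // _ /= /doubleton_eq[[-> ->]//|[vy xw]].
have [_] := parent_lt gw; rewrite -vy -xw => /(lt_trans xv).
by rewrite ltxx.
Qed.

Lemma card_parent_forest : #|parent_forest g| = #|[set v | g v != None]|.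
Proof.
apply: card_in_imset => v w; rewrite !inE.
case gv: (g v) => [x|] //; case gw: (g w) => [y|] // _ _ /=.
case/doubleton_eq => [[]//|[vy xw]].
have [_ xv] := parent_lt gv; have [_] := parent_lt gw.
by rewrite -vy -xw => /(lt_trans xv); rewrite ltxx.
Qed.

Lemma parent_forestK : parent_map (parent_forest g) = g.
Proof.
apply/ffunP => v; rewrite ffunE; case: pickP => [x /andP[xv]|none].
  by rewrite mem_parent_forest // => /eqP.
case gv: (g v) => [x|] //; have [_ xv] := parent_lt gv.
by have := none x; rewrite xv mem_parent_forest // gv eqxx.
Qed.

Lemma parent_forest_isf : symmetric e ->
  increasing_spanning_forest e (parent_forest g).
Proof.
move=> e_sym; apply/increasing_spanning_forestP; split.
  apply/subsetP => A /imsetP[v]; rewrite inE.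
  case gv: (g v) => [x|] // _ -> /=; rewrite mem_edges //.
  by have [] := parent_lt gv.
move=> v a b av bv; rewrite !mem_parent_forest // => /eqP-> /eqP.
by case.
Qed.

End ParentMaps.

Lemma parent_map_family (e : rel T) F : symmetric e ->
  F \subset edges e -> parent_map F \in family (parent_choices e).
Proof.
move=> e_sym Fe; apply/familyP => v; rewrite ffunE unfold_in.
case: pickP => [x /andP[xv vx]|//] /=.
by rewrite inE xv andbT -mem_edges //; apply: (subsetP Fe).
Qed.

(** Both sides consist of edges of [e], and every edge has a strictly larger end, at which
    [mem_parent_forest] decides membership. *)
Lemma parent_mapK (e : rel T) F : symmetric e -> irreflexive e ->
  increasing_spanning_forest e F -> parent_forest (parent_map F) = F.
Proof.
move=> e_sym e_irr /increasing_spanning_forestP[Fe one].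
have gP := parent_map_family e_sym Fe.
have key v x : (x < v)%O ->
    ([set v; x] \in parent_forest (parent_map F)) = ([set v; x] \in F).
  move=> xv; rewrite (mem_parent_forest gP) // ffunE.
  case: pickP => [y /andP[yv vy]|/(_ x)]; last by rewrite xv.
  apply/eqP/idP => [[<-]//|vx]; congr Some; exact: (one v).
have keyE v x : e v x ->
    ([set v; x] \in parent_forest (parent_map F)) = ([set v; x] \in F).
  move=> evx; have [vx|xv|vx] := ltgtP v x; last by rewrite vx e_irr in evx.
    by rewrite setUC key.
  exact: key.
have /increasing_spanning_forestP[gsub _] := parent_forest_isf gP e_sym.
apply/setP => A; have [/imsetP[[v x]]|nA] := boolP (A \in edges e).
  by rewrite inE /= => evx ->; apply: keyE.
by rewrite (contraNF (subsetP gsub A) nA) (contraNF (subsetP Fe A) nA).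
Qed.

(** * Product formula for the increasing forest polynomial *)

Local Open Scope ring_scope.

Lemma isf_polyE (e : rel T) : (0 < #|T|)%N -> symmetric e -> irreflexive e ->
  isf_poly e = \prod_v ('X - #|lower_nbrs e v|%:R%:P).
Proof.
move=> T_gt0 e_sym e_irr.
(* A root weighs ['X] and each possible parent [-1], so the choices at [v] sum to ['X - d_v];
   expanding the product sums over parent maps. *)
pose w (o : option T) : {poly int} := if o then -1 else 'X.
have -> : \prod_v ('X - #|lower_nbrs e v|%:R%:P) =
    \prod_v \sum_(o | parent_choices e v o) w o :> {poly int}.
  apply: eq_bigr => v _; rewrite (bigD1 None) //=; congr (_ + _).
  rewrite (reindex_onto Some (odflt v)) /=; last by case.
  rewrite (eq_bigl (fun x => x \in lower_nbrs e v)); last first.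
    by move=> x; rewrite eqxx !andbT.
  by rewrite sumr_const mulNrn polyC_natr.
rewrite bigA_distr_big_dep.
have wE (g : {ffun T -> option T}) :
    \prod_v w (g v) = (-1) ^+ #|[set v | g v != None]|
      * 'X^(#|T| - #|[set v | g v != None]|).
  rewrite (bigID (fun v => g v != None)) /=; congr (_ * _).
    rewrite (eq_bigr (fun=> -1)); last by move=> v; case: (g v).
    by rewrite prodr_const cardsE.
  rewrite (eq_bigr (fun=> 'X)); last by move=> v; case: (g v).
  rewrite prodr_const; congr (_ ^+ _); rewrite -cardsE cardsCs.
  by congr (_ - _)%N; apply: eq_card => v; rewrite !inE negbK.
(* The least vertex has no parent, so the range [k < #|T|] in [isf_poly] misses no forest. *)
have isf_lt F : increasing_spanning_forest e F -> (#|F| < #|T|)%N.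
  move=> isfF; have [] := increasing_spanning_forestP _ _ isfF => Fe _.
  have gP := parent_map_family e_sym Fe.
  rewrite -(parent_mapK e_sym e_irr isfF) (card_parent_forest gP).
  have [x0 _] := card_gt0P T_gt0.
  have [m _ mmin] := @Order.TotalTheory.arg_minP _ _ _ x0 predT id isT.
  rewrite -cardsT; apply: proper_card; apply/properP; split=> //.
  exists m => //; rewrite inE negbK; apply/eqP.
  case gm: (parent_map F m) => [x|] //; have [_] := parent_lt gP gm.
  by rewrite ltNge mmin.
pose c F : {poly int} := (-1) ^+ #|F| * 'X^(#|T| - #|F|).
transitivity (\sum_(F | increasing_spanning_forest e F) c F).
  rewrite (partition_big (fun F => insubd (Ordinal T_gt0) #|F|) predT) //=.
  apply: eq_bigr => k _; rewrite (eq_bigl (fun F =>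
      increasing_spanning_forest e F && (#|F| == k))); last first.
    move=> F; case: (boolP (increasing_spanning_forest e F)) => //= isfF.
    by rewrite -val_eqE val_insubd isf_lt.
  rewrite (eq_bigr (fun=> (-1) ^+ k * 'X^(#|T| - k))); last first.
    by move=> F /andP[_ /eqP FK]; rewrite /c FK.
  rewrite sumr_const /num_isf cardsE -mul_polyC rmorphM rmorphXn rmorphN1.
  by rewrite /= polyC_natr -mulrA mulr_natl mulrnAr.
rewrite (reindex_onto parent_forest parent_map); last first.
  by move=> F; apply: parent_mapK.
apply: eq_big => [g|g]; last first.
  case/andP => isfF /eqP gE; have [] := increasing_spanning_forestP _ _ isfF.
  move=> Fe _; have := parent_map_family e_sym Fe; rewrite gE => gP.
  by rewrite wE /c (card_parent_forest gP).
apply/andP/idP => [[isfF /eqP gE]|gP].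
  have [] := increasing_spanning_forestP _ _ isfF => Fe _.
  by rewrite -gE parent_map_family.
by rewrite (parent_forest_isf gP) // (parent_forestK gP).
Qed.

End IncreasingForests.

(** * Equality of the two polynomials *)

Theorem theorem6p4 (d : Order.disp_t) (T : finOrderType d) (e : rel T)
    (T_gt0 : 0 < #|T|) (e_sym : symmetric e) (e_irr : irreflexive e) :
  chromatic_poly e = isf_poly e <-> perfect_elimination e.
Proof.
rewrite isf_polyE //; split=> [chE v a b aN bN nab|peo].
  apply/negPn/negP => neab.
  have := num_colorings_gt e_sym e_irr aN bN nab neab.
  have := chromatic_polyP e #|T|; rewrite chE horner_prod.
  (* At [q = #|T|] every factor is positive, so truncated subtraction agrees with subtraction in
     [int]. *)
  rewrite (eq_bigr (fun x => (#|T| - #|lower_nbrs e x|)%N%:R)%R); last first.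
    by move=> x _; rewrite !hornerE natrB // ltnW // card_lower_nbrs_lt.
  by rewrite -natr_prod => /eqP; rewrite eqr_nat => /eqP->; rewrite ltnn.
apply/esym/chromatic_poly_unique => q.
rewrite (num_colorings_perfect_elimination q e_sym e_irr peo) horner_prod.
by apply: eq_bigr => v _; rewrite !hornerE.
Qed.
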